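(* Let $\mathcal{S}=\bigcup_j\mathcal{S}_j$ be a countable union of disjoint $(\varepsilon_j,d_j)$-configurations $\mathcal{S}_j$ in $\mathbb{T}^\omega$, with $\varepsilon_j\in(0,\frac12]$ and $d_j\in\mathbb{N}$, and let $A(\mathcal{S}):=\sup_j\frac{\varepsilon_j d_j}{\log(\varepsilon_j^{-1})}$. Then $\mathcal{M}_{\mathcal{S}}$ is bounded from $L\log L$ to $L^{1,\infty}$, in the sense that there is a constant $K<\infty$ with $$|\{x\in\mathbb{T}^\omega:\mathcal{M}_{\mathcal{S}}f(x)>\lambda\}|\le K\int_{\mathbb{T}^\omega}\frac{|f|}{\lambda}\log\Big(e+\frac{|f|}{\lambda}\Big)\,dx\quad\text{for all measurable } f \text{ and all } \lambda\in(0,\infty),$$ if and only if $A(\mathcal{S})<\infty$.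
   Context: $\mathbb{N}=\{1,2,\dots\}$; $\log$ is the natural logarithm. $\mathbb{T}^\omega$ is the product of countably many copies of $\mathbb{T}=\mathbb{R}/\mathbb{Z}$ (identified with $[0,1)$), with normalized Haar measure $dx$; $|E|$ denotes the measure of $E$. Sets $V_m$ and subgroups $H_m$, $m\in\mathbb{N}$. To each $m$ assign a finite list of positive integers (exponents) $(a_1,\dots,a_N)$ as follows. If $m=1$ the list is $(1)$. If $m=n^2+j$ with $n\ge 1$ and $1\le j\le n$, then $N=n+1$, $a_1=\dots=a_n=n$, $a_{n+1}=j$. If $m=n^2+n+j$ with $n\ge1$ and $1\le j\le n+1$, then $N=n+1$, $a_i=n+1$ for $i\le j$ and $a_i=n$ for $j<i\le n+1$. Put $V_m=\prod_{i=1}^N(0,2^{-a_i})\times\mathbb{T}\times\mathbb{T}\times\cdots$ and $H_m=\prod_{i=1}^N\{0,2^{-a_i},\dots,(2^{a_i}-1)2^{-a_i}\}\times\{0\}\times\{0\}\times\cdots$. The first $N$ coordinates are called the nonfree coordinates of $V_m$. (For example $V_2=(0,\frac12)^2\times\mathbb{T}\times\cdots$, $V_3=(0,\frac14)\times(0,\frac12)\times\mathbb{T}\times\cdots$, $V_4=(0,\frac14)^2\times\mathbb{T}\times\cdots$, $V_5=(0,\frac14)^2\times(0,\frac12)\times\mathbb{T}\times\cdots$.) Let $\mathcal{R}_0=\{t+V_m: m\in\mathbb{N},\ t\in H_m\}$. $(\varepsilon,d)$-configuration. Let $\varepsilon\in(0,\frac12]$, $d\in\mathbb{N}$, and let $Q=t+V_m\in\mathcal{R}_0$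 ($t\in H_m$) with $m$ so large that $V_m$ has at least $d$ nonfree coordinates. For $k\in\{1,\dots,d\}$ let $Q_k=T_k+Q$, where $T_k\in\mathbb{T}^\omega$ has $k$-th coordinate $(1-\varepsilon)|\pi_k(Q)|$ and all other coordinates $0$; here $\pi_k$ is the projection onto the $k$-th coordinate and $|\pi_k(Q)|$ is the length of $\pi_k(Q)\subset\mathbb{T}$. Then $\{Q_1,\dots,Q_d\}$ is called an $(\varepsilon,d)$-configuration around $Q$; an $(\varepsilon,d)$-configuration is an $(\varepsilon,d)$-configuration around some such $Q$. (The set $Q$ itself is not a member of the configuration.) Configurations $\mathcal{S}_j$ are called disjoint if the sets $\operatorname{sh}(\mathcal{S}_j):=\bigcup_{E\in\mathcal{S}_j}E$ are pairwise disjoint. Maximal operator. For a collection $\mathcal{B}$ of measurable sets of positive measure, $\mathcal{M}_{\mathcal{B}}f(x)=\sup_{B\in\mathcal{B},\,x\in B}\frac1{|B|}\int_B|f|\,dx$, with $\mathcal{M}_{\mathcal{B}}f(x)=0$ if no $B\in\mathcal{B}$ contains $x$. *)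

(* Defs.v *)
From Stdlib Require PeanoNat.
From HB Require Import structures.
From mathcomp Require Import all_boot all_order all_algebra zify.
From mathcomp Require Import all_classical all_reals all_analysis.

Set Implicit Arguments.
Unset Strict Implicit.
Unset Printing Implicit Defensive.

Import Order.TTheory GRing.Theory Num.Theory.
Import numFieldNormedType.Exports.

Local Open Scope classical_set_scope.
Local Open Scope ring_scope.

Section Circle.
Variable R : realType.

(* R / Z, each class being represented by its element in [0, 1) *)
Record circle : Type := Circle {
  circle_val :> R;
  circle_valP : 0 <= circle_val < 1 }.

HB.instance Definition _ := [isSub for circle_val].
HB.instance Definition _ := [Choice of circle by <:].

Lemma frac_subproof (x : R) : 0 <= x - (Num.floor x)%:~R < 1.
Proof.
by have /andP[h1 h2] := floor_itv x; rewrite subr_ge0 h1 ltrBlDl -intrD1.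
Qed.

Definition to_circle (x : R) : circle := Circle (frac_subproof x).

Lemma to_circleK (x : circle) : to_circle x = x.
Proof.
apply: val_inj; case: x => x hx /=.
by rewrite (_ : Num.floor x = 0) ?subr0//; apply/floor_def; rewrite add0r.
Qed.

Lemma to_circleDz (x : R) (n : int) : to_circle (x + n%:~R) = to_circle x.
Proof.
apply: val_inj => /=; rewrite floorDrz ?intr_int// intrD intrKfloor.
by rewrite opprD addrACA subrr addr0.
Qed.

Definition circle_add (x y : circle) : circle :=
  to_circle (circle_val x + circle_val y).
Definition circle_opp (x : circle) : circle := to_circle (- circle_val x).

Lemma circle_addC : commutative circle_add.
Proof. by move=> x y; rewrite /circle_add addrC. Qed.

Lemma circle_addA : associative circle_add.
Proof.
move=> x y z; rewrite /circle_add /= -!mulrNz addrA.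
by rewrite [X in _ = to_circle X]addrAC !to_circleDz addrA.
Qed.

Lemma circle_add0 : left_id (to_circle 0) circle_add.
Proof.
move=> x; rewrite /circle_add /= floor0 subr0 add0r.
exact: to_circleK.
Qed.

Lemma circle_addN : left_inverse (to_circle 0) circle_opp circle_add.
Proof.
move=> x; rewrite /circle_add /circle_opp /=.
by rewrite -mulrNz addrAC to_circleDz addNr.
Qed.

HB.instance Definition _ := GRing.isZmodule.Build circle
  circle_addA circle_addC circle_add0 circle_addN.
HB.instance Definition _ := isPointed.Build circle 0.

End Circle.

Section Torus.
Variable R : realType.

(* Coordinates are numbered from 0. *)
Definition borel_cylinders : set_system (nat -> circle R) :=
  [set A | exists (i : nat) (B : set R),
     measurable B /\ A = [set x | B (circle_val (x i))]].

(* The generated sigma-algebra is the Borel sigma-algebra of the compact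
   metrizable group (R / Z)^N. *)
Definition torus : Type := g_sigma_algebraType borel_cylinders.

HB.instance Definition _ := Measurable.copy torus
  (g_sigma_algebraType borel_cylinders).
HB.instance Definition _ := GRing.Zmodule.copy torus (nat -> circle R).

Definition translate (t : torus) (A : set torus) : set torus :=
  [set t + x | x in A].

(* The normalized Haar measure is the unique translation-invariant Borel
   probability measure. *)
Definition haar (mu : probability torus R) : Prop :=
  forall (t : torus) (A : set torus), measurable A -> mu (translate t A) = mu A.

End Torus.

(* The exponents (a_1, ..., a_N) of the box Vset m, for m >= 1. The number n of the
   definition by cases is the one such that n ^ 2 < m <= n.+1 ^ 2; see the
   three lemmas below. *)
Definition exponents (m : nat) : seq nat :=
  if (m <= 1)%N then [:: 1%N] else
  let n := Nat.sqrt m.-1 in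
  if (m <= n ^ 2 + n)%N then rcons (nseq n n) (m - n ^ 2)%N
  else let j := (m - (n ^ 2 + n))%N in nseq j n.+1 ++ nseq (n.+1 - j) n.

Lemma exponents1 : exponents 1 = [:: 1%N].
Proof. by []. Qed.

Lemma exponents_low (n j : nat) : (1 <= n)%N -> (1 <= j <= n)%N ->
  exponents (n ^ 2 + j) = rcons (nseq n n) j.
Proof.
move=> n1 jn; rewrite /exponents ifF; last by nia.
have -> : Nat.sqrt (n ^ 2 + j).-1 = n by apply: PeanoNat.Nat.sqrt_unique; nia.
by rewrite ifT; [congr rcons|]; lia.
Qed.

Lemma exponents_high (n j : nat) : (1 <= n)%N -> (1 <= j <= n.+1)%N ->
  exponents (n ^ 2 + n + j) = nseq j n.+1 ++ nseq (n.+1 - j) n.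
Proof.
move=> n1 jn; rewrite /exponents ifF; last by nia.
have -> : Nat.sqrt (n ^ 2 + n + j).-1 = n by apply: PeanoNat.Nat.sqrt_unique; nia.
by rewrite ifF; [rewrite addKn|lia].
Qed.

Section Configurations.
Variable R : realType.
Implicit Types (m : nat) (Q : set (torus R)).

Definition nonfree m : nat := size (exponents m).

Definition Vset m : set (torus R) :=
  [set x | forall i, (i < nonfree m)%N ->
     0 < circle_val (x i) < (2 ^+ nth 0%N (exponents m) i)^-1].

Definition Hgroup m : set (torus R) :=
  [set t | (forall i, (i < nonfree m)%N ->
      exists2 p : nat, (p < 2 ^ nth 0%N (exponents m) i)%N &
        t i = to_circle (p%:R / 2 ^+ nth 0%N (exponents m) i)) /\
    (forall i, (nonfree m <= i)%N -> t i = 0)].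

Definition coord_proj (k : nat) Q : set (circle R) := [set x k | x in Q].

Definition arc_length (E : set (circle R)) : R :=
  fine (lebesgue_measure [set circle_val x | x in E]).

(* Q_k, for the coordinate of index k *)
Definition shifted (eps : R) (k : nat) Q : set (torus R) :=
  translate
    (fun i => if i == k then to_circle ((1 - eps) * arc_length (coord_proj k Q)) else 0)
    Q.

Definition configuration_around (eps : R) (d : nat) Q : set_system (torus R) :=
  [set shifted eps k Q | k in [set k | (k < d)%N]].

Definition is_configuration (eps : R) (d : nat) (C : set_system (torus R)) :
    Prop :=
  exists m (t : torus R), [/\ (1 <= m)%N, Hgroup m t, (d <= nonfree m)%N &
    C = configuration_around eps d (translate t (Vset m))].

Definition sh (C : set_system (torus R)) : set (torus R) :=
  \bigcup_(E in C) E.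

End Configurations.

Section Maximal.
Variable R : realType.
Variable mu : {measure set (torus R) -> \bar R}.
Local Open Scope ereal_scope.

Definition average (f : torus R -> R) (B : set (torus R)) : \bar R :=
  (fine (mu B))^-1%:E * \int[mu]_(y in B) `|f y|%:E.

Definition maximal_op (BB : set_system (torus R)) (f : torus R -> R)
    (x : torus R) : \bar R :=
  if `[< exists2 B, BB B & B x >]
  then ereal_sup [set average f B | B in [set B | BB B /\ B x]]
  else 0.

End Maximal.

(* Main.v *)
(** Write one configuration as [Q_1, ..., Q_d] around [Q], with parameter [eps].
    Every [Q_k] has the measure of [Q]; the part of [Q_k] outside [Q] meets no
    other member, and inside [Q] the events [x \in Q_k] are independent of
    relative probability [eps].

    If the operator is bounded, test it on [f = (2 / eps) 1_Q]: every average
    over a [Q_k] is 2, so [d |Q| / 2 <= |\bigcup_k Q_k| <= K int f ln (e + f)],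
    which is [eps d = O (ln (1 / eps))].

    Conversely let [eps d <= a ln (1 / eps)], [c = 1 / a <= 1], and let [N] count
    the members [Q_k] of large average containing a point.  With [g = |f| / lam],
    [n |Q| <= int g N] for the [n] members of large average.  Young's inequality
    bounds [8 g ln (1 + c) N] by [8 g ln (e + 8 g) + ((1 + c)^N - 1)], and
    independence gives [int ((1 + c)^N - 1) <= 2 c n |Q|] because
    [eps (1 + c eps)^d <= eps exp (c eps d) <= 1]; the last term is absorbed.
    Disjointness of the shadows allows summation over the configurations. *)

Require Import Defs.
From mathcomp Require Import all_boot all_order all_algebra.
From mathcomp Require Import all_classical all_reals all_analysis.
From mathcomp Require Import measurable_realfun.
From mathcomp Require Import ring lra zify.

Set Implicit Arguments.
Unset Strict Implicit.
Unset Printing Implicit Defensive.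

Import Order.TTheory GRing.Theory Num.Theory.
Import numFieldNormedType.Exports.

Local Open Scope classical_set_scope.
Local Open Scope ring_scope.

(** * Arithmetic of representatives in [[0, 1)] *)

Section CircleArithmetic.
Variable R : realType.

Lemma to_circleD (x y : R) :
  to_circle (x + y) = to_circle x + to_circle y.
Proof.
rewrite [RHS]/(circle_add _ _) /circle_add /= -!mulrNz.
by rewrite addrACA -intrD to_circleDz.
Qed.

Lemma to_circleN (x : R) : to_circle (- x) = - to_circle x.
Proof.
apply: (addrI (to_circle x)); rewrite -to_circleD !subrr.
by apply: val_inj; rewrite /= floor0 subr0.
Qed.

Lemma to_circle_val (x : R) : 0 <= x < 1 -> circle_val (to_circle x) = x.
Proof.
by move=> x01; rewrite /= (@floor_def _ x 0) ?subr0// add0r.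
Qed.

Lemma circle_val_sub (z w : circle R) : circle_val (z - w) =
  if circle_val w <= circle_val z then circle_val z - circle_val w
  else circle_val z - circle_val w + 1.
Proof.
have -> : z - w = to_circle (circle_val z - circle_val w).
  by rewrite to_circleD to_circleN !to_circleK.
have /andP[z0 z1] := circle_valP z; have /andP[w0 w1] := circle_valP w.
case: ifPn => wz; first by rewrite to_circle_val//; lra.
rewrite -(to_circleDz _ 1) to_circle_val//.
by move: wz; rewrite -ltNge => wz; lra.
Qed.

Lemma circle_val_sub_to (z : circle R) (s : R) : 0 <= s <= 1 ->
  circle_val (z - to_circle s) =
  if s <= circle_val z then circle_val z - s else circle_val z - s + 1.
Proof.
move=> /andP[s0]; rewrite le_eqVlt => /orP[/eqP->|s1]; last first.
  by rewrite circle_val_sub to_circle_val ?s0.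
have /andP[z0 z1] := circle_valP z.
have -> : to_circle 1 = 0 :> circle R.
  by rewrite -[1]add0r (to_circleDz 0 1).
by rewrite subr0 leNgt z1 /= subrK.
Qed.

End CircleArithmetic.

(** Nonnegativity makes [h] monotone, and additivity fixes it at the multiples of [n.+1%:R^-1].
    Squeezing [s] between two neighbouring multiples leaves an error of at most [h 1 / n.+1%:R], for
    every [n]. *)
Lemma additive_nonneg_linear (R : realType) (h : R -> R) :
  (forall s u, 0 <= s -> 0 <= u -> s + u <= 1 -> h (s + u) = h s + h u) ->
  (forall s, 0 <= s <= 1 -> 0 <= h s) ->
  forall s, 0 <= s <= 1 -> h s = s * h 1.
Proof.
move=> hD h_ge0 s /andP[s0 s1].
have h1 : 0 <= h 1 by apply: h_ge0; rewrite ler01 lexx.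
have h_le u v : 0 <= u -> u <= v -> v <= 1 -> h u <= h v.
  move=> u0 uv v1; rewrite -[v](subrKC u) hD ?subr_ge0 ?subrKC//.
  by rewrite lerDl h_ge0// subr_ge0 uv /=; lra.
have hMn n u : 0 <= u -> n%:R * u <= 1 -> h (n%:R * u) = n%:R * h u.
  move=> u0; elim: n => [|n IHn] nu1.
    rewrite !mul0r; have := hD 0 0; rewrite addr0 lexx ler01 => /(_ _ _ _)/eqP.
    by rewrite -subr_eq0 opprD addrA subrr add0r oppr_eq0 => /(_ _ _ _)/eqP ->.
  rewrite -natr1 mulrDl mul1r in nu1 *.
  by rewrite hD ?IHn ?mulr_ge0//; [ring|lra].
suff bound n : n.+1%:R * `|h s - s * h 1| <= h 1.
  apply/eqP; rewrite -subr_eq0 -normr_le0 leNgt; apply/negP => D0.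
  have := bound (Num.truncn (h 1 / `|h s - s * h 1|)); apply/negP.
  by rewrite -ltNge -ltr_pdivrMr// truncnS_gt.
have n0 : 0 < n.+1%:R :> R by rewrite ltr0n.
have hn : n.+1%:R * h n.+1%:R^-1 = h 1.
  by rewrite -hMn ?mulfV// ?gt_eqF// invr_ge0 ltW.
(* For [s < 1] the upper neighbour [p.+1%:R / n.+1%:R] still lies in [[0, 1]], where additivity is
   available. *)
have [->|s_lt1] := eqVneq s 1; first by rewrite mul1r subrr normr0 mulr0.
have {s_lt1 s1} s1 : s < 1 by rewrite lt_neqAle s_lt1.
pose p := Num.truncn (n.+1%:R * s).
have /andP[ps sp] : p%:R <= n.+1%:R * s < p.+1%:R.
  by apply: truncn_itv; rewrite mulr_ge0// ltW.
have pn : (p.+1 <= n.+1)%N.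
  by rewrite ltnS -ltnS -(ltr_nat R) (le_lt_trans ps)// gtr_pMr.
have hp (q : nat) : (q <= n.+1)%N ->
    n.+1%:R * h (q%:R * n.+1%:R^-1) = q%:R * h 1.
  move=> qn; rewrite hMn ?invr_ge0 ?(ltW n0)//; first by rewrite -hn; ring.
  by rewrite ler_pdivrMr// mul1r ler_nat.
have q1 : p.+1%:R / n.+1%:R <= 1 :> R by rewrite ler_pdivrMr// mul1r ler_nat.
have lo : p%:R * h 1 <= n.+1%:R * h s.
  rewrite -hp; last exact: ltnW.
  rewrite ler_pM2l// h_le ?(ltW s1) ?divr_ge0 ?(ltW n0)//.
  by rewrite ler_pdivrMr// mulrC.
have hi : n.+1%:R * h s <= p.+1%:R * h 1.
  by rewrite -hp// ler_pM2l// h_le// ler_pdivlMr// mulrC ltW.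
rewrite -[X in X * _]gtr0_norm// -normrM mulrBr mulrA ler_norml.
rewrite -natr1 in hi sp.
move: (ler_wpM2r h1 ps) (ler_wpM2r h1 (ltW sp)) => ? ?.
by apply/andP; split; lra.
Qed.

(** * Coordinates relative to a base point, and arcs *)

Section Coordinates.
Variable R : realType.
Implicit Types (t x : torus R) (E : set (torus R)).

(** Subtracting [t] before taking representatives turns every arc met below into an interval inside
    [[0, 1]], with no wrap-around case. *)
Definition coord t i x : R := circle_val (x i - t i).

Lemma coord_ge0 t i x : 0 <= coord t i x.
Proof. by have /andP[] := circle_valP (x i - t i). Qed.

Lemma coord_lt1 t i x : coord t i x < 1.
Proof. by have /andP[] := circle_valP (x i - t i). Qed.

Lemma measurable_coord t i : measurable_fun setT (coord t i).
Proof.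
have mval : measurable_fun setT (fun x : torus R => circle_val (x i)).
  move=> _ B mB; rewrite setTI; apply: sub_sigma_algebra.
  by exists i, B.
rewrite (_ : coord t i = fun x : torus R =>
  if circle_val (t i) <= circle_val (x i) then circle_val (x i) - circle_val (t i)
  else circle_val (x i) - circle_val (t i) + 1); last first.
  by apply/funext => x; rewrite /coord circle_val_sub.
have mB : measurable_fun setT
    (fun x : torus R => circle_val (x i) - circle_val (t i)).
  exact: measurable_funB.
apply: measurable_fun_ifT => //; last exact: measurable_funD.
exact: measurable_fun_ler.
Qed.

Definition arc t i a b : set (torus R) := [set x | a < coord t i x < b].

Lemma measurable_arc t i a b : measurable (arc t i a b).
Proof.
rewrite (_ : arc t i a b = coord t i @^-1` `]a, b[).
  by rewrite -[X in measurable X]setTI; exact: measurable_coord.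
by apply/seteqP; split => x /=; rewrite in_itv.
Qed.

(** This form of independence from coordinate [i] lets measures be computed one coordinate at a time
    from translation invariance alone. *)
Definition free_of i E := forall x y : torus R,
  (forall l, l != i -> x l = y l) -> E x -> E y.

Lemma free_of_arc t i l a b : l != i -> free_of i (arc t l a b).
Proof. by move=> li x y xy; rewrite /arc /coord /= xy. Qed.

Lemma free_ofI i E F : free_of i E -> free_of i F -> free_of i (E `&` F).
Proof.
by move=> fE fF x y xy [Ex Fx]; split; [exact: fE xy Ex|exact: fF xy Fx].
Qed.

End Coordinates.

(** * Haar measure of a set cut by an arc *)

Section Haar.
Variables (R : realType) (mu : probability (torus R) R).
Hypothesis mu_haar : haar mu.
Implicit Types (t x : torus R) (E : set (torus R)).

Definition axis (i : nat) (s : R) : torus R :=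
  fun l => if l == i then to_circle s else 0.

Lemma coordB_axis t i s x : 0 <= s <= 1 -> coord t i (x - axis i s) =
  if s <= coord t i x then coord t i x - s else coord t i x - s + 1.
Proof.
move=> s01; rewrite -circle_val_sub_to// /coord; congr circle_val.
by rewrite [LHS]/((x i - axis i s i) - t i) /axis eqxx addrAC.
Qed.

Lemma translateE t E : translate t E = [set x | E (x - t)].
Proof.
apply/seteqP; split => [_ [x Ex <-]|x Ex] /=; first by rewrite addrC addKr.
by exists (x - t) => //; rewrite subrKC.
Qed.

(* The measure of [E] cut by [coord t i < s] is additive in [s] by translation
   invariance, hence linear; the open left end point is reached by squeezing. *)
Lemma haar_arc t i a b E : measurable E -> free_of i E ->
  0 <= a -> a <= b -> b <= 1 ->
  mu (E `&` arc t i a b) = ((b - a)%:E * mu E)%E.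
Proof.
move=> mE fE a0 ab b1.
(* Half-open pieces split without loss at an intermediate point, which open arcs do not. *)
pose D a b := E `&` [set x | a <= coord t i x < b].
have mD u v : measurable (D u v).
  apply: measurableI => //.
  rewrite (_ : mkset _ = coord t i @^-1` `[u, v[).
    by rewrite -[X in measurable X]setTI; exact: measurable_coord.
  by apply/seteqP; split => x /=; rewrite in_itv.
have fin A : measurable A -> mu A \is a fin_num by move=> ?; exact: fin_num_measure.
have D_split u v w : u <= v -> v <= w -> mu (D u w) = (mu (D u v) + mu (D v w))%E.
  move=> uv vw; rewrite -measureU//.
    congr (mu _); rewrite -setIUr; congr (_ `&` _).
    apply/seteqP; split => x /=; last by move=> [] /andP[? ?]; lra.
    by move=> /andP[? ?]; have [?|?] := ltP (coord t i x) v; [left|right]; lra.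
  by apply/seteqP; split => // x [] [_ /andP[? ?]] [_ /andP[? ?]]; lra.
have D_shift u v : 0 <= u -> 0 <= v -> u + v <= 1 -> mu (D u (u + v)) = mu (D 0 v).
  move=> u0 v0 uv; rewrite -(mu_haar (axis i u) (mD 0 v)) translateE.
  congr (mu _); rewrite /D.
  have shiftE x : E (x - axis i u) <-> E x.
    have axisB l : l != i -> (x - axis i u) l = x l.
      move=> /negPf li; rewrite [LHS]/(x l - axis i u l) /axis li.
      exact: subr0.
    by split; apply: fE => l li; rewrite axisB.
  apply/seteqP; split => x /=; (rewrite coordB_axis; last lra);
    move=> [Ex]; have := coord_lt1 t i x; have := coord_ge0 t i x.
    move=> ? ? /andP[? ?]; split; first exact/shiftE.
    by rewrite ifT; lra.
  move=> ? ?; case: ifPn => ? /andP[? ?]; split; try exact/shiftE; lra.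
pose h s := fine (mu (D 0 s)).
have hE s : mu (D 0 s) = (h s)%:E by rewrite fineK// fin.
have h1 : mu E = (h 1)%:E.
  rewrite -hE; congr (mu _); rewrite /D; apply/seteqP; split => x /=; last by case.
  by rewrite coord_ge0 coord_lt1.
have h_lin s : 0 <= s <= 1 -> h s = s * h 1.
  apply: additive_nonneg_linear => [u v u0 v0 uv|u u01]; last first.
    by rewrite fine_ge0.
  apply: EFin_inj; rewrite EFinD -!hE (D_split 0 u) ?lerDl//.
  by rewrite D_shift.
have Dlin u v : 0 <= u -> u <= v -> v <= 1 -> mu (D u v) = ((v - u) * h 1)%:E.
  move=> u0 uv v1; rewrite -[v](subrKC u) D_shift ?subr_ge0 ?subrKC// hE h_lin//.
  by rewrite subr_ge0 uv/=; lra.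
have mA : measurable (E `&` arc t i a b).
  by apply: measurableI => //; exact: measurable_arc.
have hge0 : 0 <= h 1 by rewrite fine_ge0.
rewrite h1 -EFinM; apply/eqP; rewrite eq_le; apply/andP; split.
  rewrite -Dlin// le_measure ?inE//.
  by move=> x [Ex /andP[? ?]]; split => //=; lra.
rewrite -(fineK (fin _ mA)) lee_fin; apply/ler_addgt0Pr => e e0.
(* Cutting a piece of length [e / (h 1 + 1)] off the left end costs at most [e]; the [+ 1] guards
   against [h 1 = 0]. *)
have h10 : 0 < h 1 + 1 by lra.
have eh : 0 < e / (h 1 + 1) by rewrite divr_gt0.
have ehe : e / (h 1 + 1) * h 1 <= e.
  by rewrite -mulrA ler_piMr ?(ltW e0)// ler_pdivrMl// mulr1; lra.
have [abe|abe] := leP b (a + e / (h 1 + 1)).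
  rewrite (le_trans (y := e / (h 1 + 1) * h 1))//.
    by rewrite ler_wpM2r//; lra.
  by rewrite (le_trans ehe)// lerDr fine_ge0.
have : (((b - (a + e / (h 1 + 1))) * h 1)%:E <= mu (E `&` arc t i a b))%E.
  rewrite -Dlin//; [|lra|lra].
  rewrite le_measure ?inE//.
  by move=> x [Ex /andP[? ?]]; split => //=; rewrite /arc /=; lra.
rewrite -(fineK (fin _ mA)) lee_fin => lo.
lra.
Qed.

End Haar.

(** * Product formulas for boxes *)

Section Boxes.
Variables (R : realType) (mu : probability (torus R) R).
Hypothesis mu_haar : haar mu.
Implicit Types (t x : torus R) (E : set (torus R)) (a b c : nat -> R).

Definition box t N a b : set (torus R) :=
  [set x | forall i, (i < N)%N -> arc t i (a i) (b i) x].

Lemma measurable_box t N a b : measurable (box t N a b).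
Proof.
rewrite (_ : box t N a b =
    \bigcap_i (if (i < N)%N then arc t i (a i) (b i) else setT)).
  apply: bigcapT_measurable => i; case: ifP => // _; exact: measurable_arc.
apply/seteqP; split => [x xB i _|x xB i iN]; last by have := xB i I; rewrite iN.
by case: ifP => // iN; exact: xB.
Qed.

Lemma indic_box t N a b x :
  \1_(box t N a b) x = \prod_(i < N) \1_(arc t i (a i) (b i)) x :> R.
Proof.
rewrite indicE; case: (boolP (x \in _)); rewrite ?inE ?notin_setE => xB.
  by rewrite big1// => i _; rewrite indicE mem_set//; exact: xB.
move: xB; rewrite -existsNE => -[i /not_implyP[iN xi]].
by rewrite (bigD1 (Ordinal iN))//= indicE memNset// mul0r.
Qed.

Lemma indicIM (T : Type) (A B : set T) (x : T) :
  \1_(A `&` B) x = \1_A x * \1_B x :> R.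
Proof. by rewrite !indicE in_setI -natrM mulnb. Qed.

(** Independence of the coordinates, with weights so that factors [1 + c * \1_] are covered.
    Expanding the last factor replaces [E] by [E] cut by an arc of coordinate [r]; the cut set stays
    free of the earlier coordinates, and [haar_arc] gives its measure. *)
Lemma integral_prod_arcs t r E a b a' b' c : measurable E ->
  (forall i, (i < r)%N -> [/\ free_of i E, 0 <= c i,
     [/\ 0 <= a i, a i <= b i & b i <= 1] &
     [/\ 0 <= a' i, a' i <= b' i & b' i <= 1]]) ->
  (\int[mu]_x (\1_E x * \prod_(i < r)
     (\1_(arc t i (a i) (b i)) x + c i * \1_(arc t i (a' i) (b' i)) x))%:E =
   (\prod_(i < r) (b i - a i + c i * (b' i - a' i)))%:E * mu E)%E.
Proof.
elim: r E => [|r IHr] E mE H.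
  rewrite big_ord0 mul1e; under eq_integral do rewrite big_ord0 mulr1.
  by rewrite integral_indic// setIT.
pose F E x := \1_E x * \prod_(i < r)
  (\1_(arc t i (a i) (b i)) x + c i * \1_(arc t i (a' i) (b' i)) x) : R.
have [fE c0 [a0 ab b1] [a'0 ab' b'1]] := H r (ltnSn r).
have mF E' : measurable E' -> measurable_fun setT (fun x => (F E' x)%:E).
  move=> mE'; apply/measurable_EFinP.
  apply: measurable_funM; first exact: measurable_indic.
  apply: measurable_prod => i _; apply: measurable_funD.
    by apply: measurable_indic; exact: measurable_arc.
  by apply: measurable_funM => //; apply: measurable_indic; exact: measurable_arc.
have F0 E' x : (0 <= (F E' x)%:E)%E.
  rewrite lee_fin mulr_ge0 ?indicE// prodr_ge0// => i _.
  rewrite addr_ge0 ?mulr_ge0//.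
  by have [] := H i (ltnW (ltn_ord i)).
have mEI u v : measurable (E `&` arc t r u v).
  by apply: measurableI => //; exact: measurable_arc.
have IH u v : 0 <= u -> u <= v -> v <= 1 -> (\int[mu]_x (F (E `&` arc t r u v) x)%:E =
    (\prod_(i < r) (b i - a i + c i * (b' i - a' i)))%:E * ((v - u)%:E * mu E))%E.
  move=> u0 uv v1; rewrite IHr//; first by rewrite haar_arc.
  move=> i ir; have [fE' ? ? ?] := H i (ltnW ir); split => //.
  by apply: free_ofI => //; apply: free_of_arc; rewrite gtn_eqF.
rewrite (eq_integral (fun x => (F (E `&` arc t r (a r) (b r)) x)%:E +
    (c r)%:E * (F (E `&` arc t r (a' r) (b' r)) x)%:E)%E); last first.
  move=> x _; rewrite big_ord_recr/= -EFinM -EFinD /F !indicIM; congr EFin.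
  by ring.
rewrite ge0_integralD//; last 3 first.
- exact: mF.
- by move=> x _; rewrite mule_ge0.
- by apply: emeasurable_funM => //; exact: mF.
rewrite ge0_integralZl//; last exact: mF.
rewrite !IH// big_ord_recr/= -[mu E]fineK ?fin_num_measure//.
by rewrite -!EFinM -EFinD; congr EFin; ring.
Qed.

Lemma haar_box t N a b :
  (forall i, (i < N)%N -> [/\ 0 <= a i, a i <= b i & b i <= 1]) ->
  (mu (box t N a b) = (\prod_(i < N) (b i - a i))%:E)%E.
Proof.
move=> ab; rewrite -[X in mu X]setIT -integral_indic//; last exact: measurable_box.
rewrite (eq_integral (fun x => (\1_(setT : set (torus R)) x * \prod_(i < N)
    (\1_(arc t i (a i) (b i)) x + 0 * \1_(arc t i (a i) (b i)) x))%:E)); last first.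
  move=> x _; rewrite indic_box indicT mul1r.
  by under [in RHS]eq_bigr do rewrite mul0r addr0.
rewrite (@integral_prod_arcs _ _ _ _ _ _ _ (fun=> 0))//; last first.
  by move=> i /ab abi; split.
rewrite probability_setT mule1.
by congr EFin; apply: eq_bigr => i _; rewrite mul0r addr0.
Qed.

End Boxes.

(** * The boxes [Vset m], their translates and their shifts *)

Section BoxGeometry.
Variable R : realType.
Implicit Types (t x : torus R) (m : nat).

Definition side m i : R := (2 ^+ nth 0%N (exponents m) i)^-1.

Lemma side_gt0 m i : 0 < side m i.
Proof. by rewrite invr_gt0 exprn_gt0. Qed.

(** For [m >= 2] the square root [n] is at least 1, and [m - n ^ 2] is positive because
    [n ^ 2 <= m.-1]. *)
Lemma exponents_gt0 m i : (1 <= m)%N -> (i < nonfree m)%N ->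
  (0 < nth 0%N (exponents m) i)%N.
Proof.
rewrite /nonfree /exponents => m1.
case: ifPn => [_|m2]; first by case: i.
set n := Nat.sqrt _.
have : (n * n <= m.-1 < n.+1 * n.+1)%N.
  by have := PeanoNat.Nat.sqrt_spec m.-1 (PeanoNat.Nat.le_0_l _); rewrite -/n; lia.
move=> /andP[n_lo n_hi].
have n0 : (0 < n)%N by nia.
case: ifPn => mn.
  rewrite size_rcons size_nseq nth_rcons size_nseq nth_nseq ltnS => i_n.
  case: (ltnP i n) => // ni; case: eqP => [_|]; last by lia.
  by nia.
rewrite size_cat !size_nseq nth_cat size_nseq !nth_nseq => i_n.
by case: ifP => // ?; case: ifP => //; lia.
Qed.

Lemma side_le_half m i : (1 <= m)%N -> (i < nonfree m)%N -> side m i <= 2^-1.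
Proof.
move=> m1 iN; rewrite lef_pV2 ?posrE ?exprn_gt0//.
by rewrite -[X in X <= _]expr1 ler_eXn2l ?ltr1n ?exponents_gt0.
Qed.

Lemma translate_Vset t m :
  translate t (@Vset R m) = box t (nonfree m) (fun=> 0) (side m).
Proof. by rewrite translateE. Qed.

(** A grid point [p / 2 ^ a] with [p < 2 ^ a] leaves room for one more cell, so the projection of
    the translated box is an honest interval in [[0, 1]]. *)
Lemma Hgroup_side m t k : Hgroup m t -> (k < nonfree m)%N ->
  circle_val (t k) + side m k <= 1.
Proof.
move=> [Ht _] kN; have [p p_lt ->] := Ht k kN.
have e0 : 0 < 2 ^+ nth 0%N (exponents m) k :> R by rewrite exprn_gt0.
rewrite to_circle_val; last first.
  rewrite divr_ge0 ?ltr_pdivrMr ?mul1r ?ler0n ?(ltW e0)//.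
  by rewrite -natrX ltr_nat.
rewrite /side -[X in _ + X]mul1r -mulrDl ler_pdivrMr// mul1r natr1.
by rewrite -natrX ler_nat.
Qed.

Lemma arc_length_Vset m t k : Hgroup m t -> (k < nonfree m)%N ->
  arc_length (coord_proj k (translate t (@Vset R m))) = side m k.
Proof.
move=> Ht kN; have tk1 := Hgroup_side Ht kN.
have s0 := side_gt0 m k.
have /andP[tk0 _] := circle_valP (t k).
rewrite /arc_length (_ : [set circle_val x | x in _] =
    [set` `]circle_val (t k), circle_val (t k) + side m k[]).
  rewrite lebesgue_measure_itv/= lte_fin ltrDl s0 -EFinB/=; ring.
rewrite translate_Vset; apply/seteqP; split => [v|v] /=.
  move=> [_ [x xB <-] <-]; move: (xB k kN); rewrite /arc/= in_itv/= /coord.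
  have /andP[xk0 _] := circle_valP (x k).
  by rewrite circle_val_sub; case: ifPn => ? /andP[? ?]; lra.
rewrite in_itv/= => /andP[v_lo v_hi].
have v01 : 0 <= v < 1 by lra.
exists (to_circle v); last by rewrite to_circle_val.
(* The coordinates other than [k] are placed at the midpoints of their sides. *)
exists (fun i => if i == k then to_circle v else t i + to_circle (side m i / 2));
  last by rewrite eqxx.
move=> i iN; rewrite /arc /= /coord; have [->|ik] := eqVneq i k.
  rewrite circle_val_sub to_circle_val// ifT; lra.
have si0 := side_gt0 m i.
have si1 : side m i <= 1.
  by rewrite invf_le1 ?exprn_gt0// exprn_ege1// ler1n.
by rewrite addrC addKr to_circle_val; lra.
Qed.

(** Left end of the [i]-th interval of [Q_k], measured from [t i]. *)
Definition shift_lo (eps : R) m k i := (if i == k then 1 - eps else 0) * side m i.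

(* As [side <= 1/2], the shifted interval ends at [(2 - eps) * side] after the
   origin [t k] and meets the unshifted one on one side only. *)
Lemma shifted_box eps m t k : 0 < eps <= 2^-1 -> (1 <= m)%N -> Hgroup m t ->
  (k < nonfree m)%N -> shifted eps k (translate t (@Vset R m)) =
  box t (nonfree m) (shift_lo eps m k) (fun i => shift_lo eps m k i + side m i).
Proof.
move=> /andP[e0 e1] m1 Ht kN.
rewrite /shifted arc_length_Vset// translate_Vset translateE.
rewrite -/(axis k ((1 - eps) * side m k)).
have sk0 := side_gt0 m k; have sk1 := side_le_half m1 kN.
have es : 0 <= eps * side m k by rewrite mulr_ge0 ?ltW.
have es' : eps * side m k <= 2^-1 * side m k by rewrite ler_wpM2r// ltW.
have coord_axis i x : i != k ->
    coord t i (x - axis k ((1 - eps) * side m k)) = coord t i x.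
  move=> /negPf ik; rewrite /coord -[X in circle_val X]/(x i -
    axis k ((1 - eps) * side m k) i - t i) /axis ik.
  by congr (circle_val (_ - t i)); exact: subr0.
apply/seteqP; split => x xB i iN; have := xB i iN; rewrite /arc /shift_lo/=;
  (have [->|ik] := eqVneq i k; last by rewrite coord_axis// mul0r add0r);
  (rewrite coordB_axis; last by lra).
  by case: ifPn => ? /andP[? ?]; have := coord_ge0 t k x; lra.
by case: ifPn => ? /andP[? ?]; lra.
Qed.

End BoxGeometry.

(** * Elementary inequalities for [expR] and [ln] *)

Section RealInequalities.
Variable R : realType.
Implicit Types (a b c g y : R).

(** Square the tangent-line bound [1 / 2 <= expR (- (1 / 2))]. *)
Lemma expR1_le4 : expR 1 <= 4 :> R.
Proof.
have h : 1 / 2 <= expR (- (1 / 2)) :> R.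
  by apply: le_trans (expR_ge1Dx _); lra.
have : expR (- (1 / 2)) * expR (- (1 / 2)) * expR 1 = 1 :> R.
  by rewrite -!expRD (_ : _ + 1 = 0) ?expR0//; lra.
have : 1 / 2 * (1 / 2) <= expR (- (1 / 2)) * expR (- (1 / 2)) :> R.
  by apply: ler_pM => //; lra.
by move=> /(ler_wpM2r (expR_ge0 (1 : R))); lra.
Qed.

Lemma ln_expR1D_ge1 a : 0 <= a -> 1 <= ln (expR 1 + a).
Proof.
move=> a0; rewrite -[X in X <= _](expRK 1) ler_ln ?posrE ?expR_gt0 ?lerDl//.
by rewrite ltr_wpDr ?expR_gt0.
Qed.

(** For [a <= 1], [a * b <= b <= expR b - 1]. For [a > 1], the tangent of [expR] at [ln a] gives
    [a * (1 + b - ln a) <= expR b]. *)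
Lemma young_expR a b : 0 <= a -> 0 <= b ->
  a * b <= a * ln (expR 1 + a) + (expR b - 1).
Proof.
move=> a0 b0; have h := ln_expR1D_ge1 a0.
have [a1|a1] := leP a 1.
  have := expR_ge1Dx b; have : a * b <= b by rewrite ler_piMl.
  have : 0 <= a * ln (expR 1 + a) by rewrite mulr_ge0// (le_trans _ h).
  lra.
have a_gt0 : 0 < a by lra.
have lna : ln a <= ln (expR 1 + a).
  by rewrite ler_ln ?posrE ?lerDr ?expR_ge0// ltr_wpDl ?expR_ge0.
have : a * (1 + (b - ln a)) <= expR b.
  rewrite -[X in _ <= X](_ : a * expR (b - ln a) = _).
    by rewrite ler_pM2l// expR_ge1Dx.
  by rewrite expRB lnK ?posrE// mulrCA divff ?mulr1// gt_eqF.
have := ler_wpM2l a0 lna; lra.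
Qed.

(** Here [ln 8 <= 7], and [ln (expR 1 + g)] is at least 1. *)
Lemma ln_expR1D_mul8 g : 0 <= g -> ln (expR 1 + 8 * g) <= 8 * ln (expR 1 + g).
Proof.
move=> g0; have h := ln_expR1D_ge1 g0; have e0 := expR_gt0 (1 : R).
rewrite (le_trans (y := ln (8 * (expR 1 + g))))//.
  by rewrite ler_ln ?posrE; lra.
rewrite lnM ?posrE; [|lra|lra].
have : ln (1 + 7) <= 7 :> R by apply: le_ln1Dx; lra.
by rewrite (_ : 1 + 7 = 8); lra.
Qed.

(** The upper bound for [ln], applied to [(1 + c)^-1], yields [c / (1 + c) <= ln (1 + c)]. *)
Lemma ln1D_ge_half c : 0 <= c <= 1 -> c / 2 <= ln (1 + c).
Proof.
move=> /andP[c0 c1].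
have c2 : 0 < 1 + c by lra.
have : ln (1 + (- (c / (1 + c)))) <= - (c / (1 + c)).
  by apply: le_ln1Dx; rewrite ltrN2 ltr_pdivrMr//; lra.
rewrite (_ : 1 + - (c / (1 + c)) = (1 + c)^-1); last by field; rewrite gt_eqF.
rewrite lnV ?posrE// => h.
have : c / 2 <= c / (1 + c) by rewrite ler_wpM2l// lef_pV2 ?posrE//; lra.
lra.
Qed.

(** Each term attaches to one index [k] only the factors before it; this reduces an exponential
    moment of the overlap count to one integral per member, as in [shifted_overlap_le]. *)
Lemma prod1D_telescope c (q : nat -> R) r :
  \prod_(l < r) (1 + c * q l) =
  1 + c * \sum_(k < r) q k * \prod_(l < k) (1 + c * q l).
Proof.
elim: r => [|r IHr]; first by rewrite !big_ord0 mulr0 addr0.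
by rewrite big_ord_recr [in RHS]big_ord_recr/= [in RHS]mulrDr addrA -IHr; ring.
Qed.

Lemma expR_ln1D_sum c (q : nat -> bool) r : 0 <= c ->
  expR (ln (1 + c) * \sum_(l < r) (q l)%:R) = \prod_(l < r) (1 + c * (q l)%:R).
Proof.
move=> c0; rewrite mulr_sumr expR_sum; apply: eq_bigr => l _.
by case: (q l); rewrite ?mulr1 ?mulr0 ?addr0 ?expR0// lnK// posrE; lra.
Qed.

(* Young's inequality for [8 * g] and [ln (1 + c) * N], [N] the number of [k] with
   [q k], after telescoping [(1 + c) ^+ N - 1]. *)
Lemma mul_overlap_le c g (q : nat -> bool) r : 0 < c <= 1 -> 0 <= g ->
  g * \sum_(k < r) (q k)%:R <= 16 / c * (g * ln (expR 1 + g)) +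
    4^-1 * \sum_(k < r) (q k)%:R * \prod_(l < k) (1 + c * (q l)%:R).
Proof.
move=> /andP[c0 c1] g0.
have ch : 0 <= c <= 1 by rewrite c1 ltW.
have s0 : 0 <= \sum_(k < r) (q k)%:R :> R by rewrite sumr_ge0.
have d0 := ln1D_ge_half ch.
have g8 : 0 <= 8 * g by rewrite mulr_ge0.
have b0 : 0 <= ln (1 + c) * \sum_(k < r) (q k)%:R by rewrite mulr_ge0//; lra.
have := young_expR g8 b0.
rewrite expR_ln1D_sum ?(ltW c0)// (prod1D_telescope c (fun l => (q l)%:R)).
set s := \sum_(k < r) (q k)%:R in s0 *.
set p := \sum_(k < r) _ * _.
move=> h.
(* With [h] these give [4 * c * g * s <= 64 * g * ln (expR 1 + g) + c * p], which is then divided by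
   [4 * c]. *)
have h8 := ler_wpM2l g8 (ln_expR1D_mul8 g0).
have hs := ler_wpM2l g8 (ler_wpM2r s0 d0).
rewrite -(ler_pM2l c0) [X in _ <= X](_ : _ =
  16 * (g * ln (expR 1 + g)) + 4^-1 * (c * p)); last by field; rewrite gt_eqF.
lra.
Qed.

(** For [y >= 2] one has [expR 1 + 2 * y <= 4 + 2 * y <= 4 * y <= y ^+ 3]. *)
Lemma ln_expR1D_le_ln y : 2 <= y -> ln (expR 1 + 2 * y) <= 3 * ln y.
Proof.
move=> y2; have e0 := expR_gt0 (1 : R); have e4 := expR1_le4.
have y0 : 0 < y by lra.
rewrite (mulr_natl (ln y) 3) -lnXn// ler_ln ?posrE ?exprn_gt0//; last lra.
have yy : 2 * 2 <= y * y by rewrite ler_pM.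
have := ler_wpM2r (ltW y0) yy; rewrite !exprS expr0; lra.
Qed.

End RealInequalities.

(** * Summation of local estimates over a countable family *)

Section MeasureTools.
Variables (d : measure_display) (T : measurableType d) (R : realType).
Variable mu : {measure set T -> \bar R}.
Local Open Scope ereal_scope.

Lemma measurable_bigcup_countType (J : countType) (F : J -> set T) :
  (forall j, measurable (F j)) -> measurable (\bigcup_j F j).
Proof. by move=> mF; apply: countable_bigcupT_measurable => //; exact: countableP. Qed.

(** Disjointness of the [G j] makes both sides additive: the measures over the smaller sets [F j],
    the integrals over the [G j]. *)
Lemma le_measure_bigcup_integral (J : countType) (F G : J -> set T)
    (phi : T -> \bar R) :
  (forall j, measurable (F j)) -> (forall j, measurable (G j)) ->
  (forall j, F j `<=` G j) -> trivIset setT G ->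
  measurable_fun setT phi -> (forall x, 0 <= phi x) ->
  (forall j, mu (F j) <= \int[mu]_(x in G j) phi x) ->
  mu (\bigcup_j F j) <= \int[mu]_x phi x.
Proof.
move=> mF mG FG tG mphi phi0 H.
(* Natural numbers that code no index receive the empty set. *)
pose ext (A : J -> set T) n := oapp A set0 (@pickle_inv J n).
have ext_bigcup A : \bigcup_j A j = \bigcup_n ext A n.
  apply/seteqP; split => x [j _ xj].
    by exists (pickle j) => //; rewrite /ext pickleK_inv.
  by move: xj; rewrite /ext; case: pickle_inv => //= k ?; exists k.
have mext A : (forall j, measurable (A j)) -> forall n, measurable (ext A n).
  by move=> mA n; rewrite /ext; case: pickle_inv => /=.
have text A : trivIset setT A -> trivIset setT (ext A).
  move=> tA m n _ _ [x]; rewrite /ext.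
  have := @pickle_invK J m; have := @pickle_invK J n.
  case: (pickle_inv m) => [j|]; case: (pickle_inv n) => [k|] //=; try by move=> ? ? [].
  by move=> <- <- [xj xk]; rewrite (tA j k)//; exists x.
have tF : trivIset setT F.
  move=> j k _ _ [x [xj xk]]; apply: tG => //.
  by exists x; split; exact: FG.
rewrite ext_bigcup measure_bigcup//; [|by move=> ? _; exact: mext|exact: text].
rewrite (@le_trans _ _ (\int[mu]_(x in \bigcup_n ext G n) phi x))//; last first.
  apply: ge0_subset_integral => //.
  by apply: bigcup_measurable => n _; exact: mext.
rewrite ge0_integral_bigcup//; [|exact: mext|exact: measurable_funTS|exact: text].
rewrite (eq_eseriesl (Q := xpredT)); last by move=> n; rewrite in_setT.
apply: lee_nneseries => // n _; rewrite /ext.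
by case: pickle_inv => [j|]//=; rewrite measure0 integral_set0.
Qed.

Lemma integral_indicr (D A : set T) (f : T -> R) : A `<=` D ->
  \int[mu]_(x in A) (f x)%:E = \int[mu]_(x in D) (f x * \1_A x)%:E.
Proof.
move=> AD; rewrite -{1}(setIidr AD) integral_mkcondr.
apply: eq_integral => x _; rewrite patchE indicE.
by case: (x \in A); rewrite ?mulr1 ?mulr0.
Qed.

End MeasureTools.

(** * Where the maximal operator is large *)

Section Superlevel.
Variables (R : realType) (mu : {measure set (torus R) -> \bar R}).

Lemma maximal_op_superlevel (BB : set_system (torus R)) (f : torus R -> R)
    (lam : R) : 0 < lam ->
  [set x | (lam%:E < maximal_op mu BB f x)%E] =
  \bigcup_(B in [set B | BB B /\ (lam%:E < average mu f B)%E]) B.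
Proof.
move=> lam0; apply/seteqP; split => [x|x [B [BBB lB] xB]] /=; rewrite /maximal_op.
  case: asboolP => [_ /ereal_sup_gt[_ [B [BBB xB] <-] lB]|_]; first by exists B.
  (* A point in no member has value 0, which is not above [lam]. *)
  by rewrite lte_fin ltNge ltW.
case: asboolP => [_|[]]; last by exists B.
by apply: lt_le_trans lB _; apply: ereal_sup_ubound; exists B.
Qed.

End Superlevel.

(** * Upper and lower estimates for one configuration *)

Section OneConfiguration.
Variables (R : realType) (mu : probability (torus R) R).
Hypothesis mu_haar : haar mu.
Variables (eps : R) (m d : nat) (t : torus R).
Hypotheses (eps_range : 0 < eps <= 2^-1) (m1 : (1 <= m)%N).
Hypotheses (Ht : Hgroup m t) (dN : (d <= nonfree m)%N).

Let Q := translate t (@Vset R m).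
(** The common measure of [Q] and its shifts. *)
Let w : R := \prod_(i < nonfree m) side R m i.

Let w_gt0 : 0 < w.
Proof. by apply: prodr_gt0 => i _; exact: side_gt0. Qed.

Let ltdN k : (k < d)%N -> (k < nonfree m)%N.
Proof. by move=> kd; exact: leq_trans dN. Qed.

Let side_bounds i : (i < nonfree m)%N ->
  [/\ 0 <= side R m i, side R m i <= 2^-1 &
    0 <= eps * side R m i <= 2^-1 * side R m i].
Proof.
move=> iN; have s0 := ltW (side_gt0 R m i); have s1 := side_le_half R m1 iN.
have /andP[e0 e1] := eps_range.
by split=> //; rewrite mulr_ge0 ?ler_wpM2r// ltW.
Qed.

Lemma shift_lo_bounds k i : (i < nonfree m)%N ->
  [/\ 0 <= shift_lo eps m k i, shift_lo eps m k i <= side R m i &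
    shift_lo eps m k i + side R m i <= 1].
Proof.
move=> iN; have [s0 s1 /andP[es0 es1]] := side_bounds iN.
by rewrite /shift_lo; case: eqP => _; split; lra.
Qed.

Lemma measurable_shifted k : (k < d)%N -> measurable (shifted eps k Q).
Proof.
by move=> kd; rewrite shifted_box ?ltdN//; exact: measurable_box.
Qed.

Lemma haar_shifted k : (k < d)%N -> mu (shifted eps k Q) = w%:E.
Proof.
move=> kd; rewrite shifted_box ?ltdN// haar_box//; last first.
  move=> i iN; have [? ? ?] := shift_lo_bounds k iN.
  have [? _ _] := side_bounds iN.
  by split=> //; lra.
by congr EFin; apply: eq_bigr => i _; rewrite addrC addKr.
Qed.

(* Outside [Q] the product is [1]; inside [Q] independence of the coordinates gives
   [eps * (1 + c * eps) ^+ k * w <= w], which is the integral of [psi]. *)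
Lemma shifted_overlap_le c k : (k < d)%N -> 0 <= c -> expR (c * eps * d%:R) <= eps^-1 ->
  (\int[mu]_x (\1_(shifted eps k Q) x *
     \prod_(l < k) (1 + c * \1_(shifted eps l Q) x))%:E <= (2 * w)%:E)%E.
Proof.
move=> kd c0 hc; have kN := ltdN kd.
have /andP[e0 e1] := eps_range.
pose ck i := if (i < k)%N then c else 0.
pose lo i := (1 - eps) * side R m i.
(* The first arcs describe [Q_k] cut by [Q]; for a point of [Q], the weighted arcs detect membership
   in [Q_i], [i < k]. *)
pose psi x : R := \prod_(i < nonfree m)
  (\1_(arc t i (shift_lo eps m k i) (side R m i)) x
   + ck i * \1_(arc t i (lo i) (side R m i)) x).
have ck0 i : 0 <= ck i by rewrite /ck; case: ifP.
have psi0 x : 0 <= psi x.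
  by rewrite prodr_ge0// => i _; rewrite addr_ge0 ?mulr_ge0.
have int_psi : (\int[mu]_x (psi x)%:E <= w%:E)%E.
  rewrite (eq_integral (fun x => (\1_(setT : set (torus R)) x * psi x)%:E)); last first.
    by move=> x _; rewrite indicT mul1r.
  rewrite (integral_prod_arcs mu_haar)//; last first.
    move=> i iN; have [? ? ?] := shift_lo_bounds k iN.
    have [? ? /andP[? ?]] := side_bounds iN.
    by split; rewrite /lo//; split; lra.
  rewrite probability_setT mule1 lee_fin.
  rewrite (eq_bigr (fun i : 'I__ => side R m i *
      ((if i == Ordinal kN then eps else 1) * (1 + ck i * eps)))); last first.
    move=> i _; rewrite /shift_lo /lo -val_eqE/= /ck.
    by case: eqP => [->|_]; rewrite ?ltnn; ring.
  rewrite big_split/= ler_piMr//; first by rewrite ltW.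
  rewrite big_split/= -big_mkcond/= big_pred1_eq.
  rewrite -ler_pdivlMl// mulr1 (le_trans _ hc)//.
  rewrite (le_trans (y := \prod_(i < nonfree m) expR (ck i * eps)))//.
    apply: ler_prod => i _; rewrite expR_ge1Dx andbT.
    by rewrite addr_ge0// mulr_ge0// ltW.
  rewrite -expR_sum ler_expR -mulr_suml mulrAC ler_wpM2r ?(ltW e0)//.
  rewrite -big_mkcond/= -(big_ord_widen _ (fun=> c)) ?(ltnW kN)//.
  by rewrite sumr_const card_ord -(mulr_natr c) ler_wpM2l// ler_nat ltnW.
have mq l : (l < d)%N -> measurable_fun setT (\1_(shifted eps l Q) : torus R -> R).
  by move=> ld; apply: measurable_indic; exact: measurable_shifted.
have mpsi : measurable_fun setT psi.
  apply: measurable_prod => i _; apply: measurable_funD; last apply: measurable_funM => //;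
    by apply: measurable_indic; exact: measurable_arc.
apply: (@le_trans _ _ (\int[mu]_x ((\1_(shifted eps k Q) x)%:E + (psi x)%:E))%E).
  apply: ge0_le_integral => //.
  - by move=> x _; rewrite lee_fin mulr_ge0// prodr_ge0// => l _; rewrite addr_ge0 ?mulr_ge0.
  - apply/measurable_EFinP; apply: measurable_funM; first exact: mq.
    apply: measurable_prod => l _; apply: measurable_funD => //.
    by apply: measurable_funM => //; apply: mq; rewrite (ltn_trans _ kd).
  - by apply: emeasurable_funD; apply/measurable_EFinP => //; exact: mq.
  move=> x _; rewrite -EFinD lee_fin.
  rewrite [\1__ x]indicE; case: (boolP (x \in _)); rewrite ?mul0r ?add0r//.
  rewrite inE shifted_box// => xQ; rewrite mul1r.
  have := xQ k kN; rewrite /arc /shift_lo eqxx/= => /andP[xk_lo xk_hi].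
  (* Past the side in coordinate [k] no other [Q_l] contains [x]: the product is 1, and the
     indicator of [Q_k] pays for it. *)
  have [xk|xk] := ltP (coord t k x) (side R m k); last first.
    rewrite big1 ?lerDl// => l _; rewrite indicE memNset ?mulr0 ?addr0//.
    rewrite shifted_box ?(ltn_trans (ltn_ord l))// => /(_ k kN).
    rewrite /arc /shift_lo/= gtn_eqF// mul0r add0r => /andP[_].
    by rewrite ltNge xk.
  (* In the remaining case [x] lies in [Q], and the product is compared with [psi x] factor by
     factor. *)
  rewrite (le_trans _ (_ : psi x <= _)) ?lerDr//.
  rewrite (big_ord_widen (nonfree m) (fun l => 1 + c * \1_(shifted eps l Q) x)) ?(ltnW kN)//.
  rewrite big_mkcond/=; apply: ler_prod => i _; apply/andP; split.
    by case: ifP => // _; rewrite addr_ge0// mulr_ge0.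
  have iN := ltn_ord i.
  have x_hi : coord t i x < side R m i.
    have [->//|ik] := eqVneq (i : nat) k.
    by have := xQ i iN; rewrite /arc /shift_lo/= (negPf ik) mul0r add0r => /andP[].
  have x_lo : shift_lo eps m k i < coord t i x by have /andP[] := xQ i iN.
  have -> : \1_(arc t i (shift_lo eps m k i) (side R m i)) x = 1 :> R.
    by rewrite indicE mem_set// /arc/= x_lo.
  rewrite /ck; case: ifP => ik; last by rewrite mul0r addr0.
  rewrite lerD2l ler_wpM2l// !indicE; case: (boolP (x \in shifted _ _ _)) => //.
  rewrite inE shifted_box// => /(_ i iN).
  rewrite /arc /shift_lo/= eqxx => /andP[xi_lo _].
  by rewrite mem_set// /lo/= xi_lo.
rewrite ge0_integralD//; last 3 first.
- by apply/measurable_EFinP; exact: mq.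
- by move=> x _; rewrite lee_fin.
- exact/measurable_EFinP.
rewrite integral_indic// ?setIT; last exact: measurable_shifted.
by rewrite [X in (X + _)%E]haar_shifted// mulr_natl mulr2n EFinD leeD2l.
Qed.

(** [F] selects the members of large average. Their total measure is at most the integral of [g]
    times the overlap count; [mul_overlap_le] returns half of [n * w], and absorbing that half
    doubles [16 / c]. *)
Lemma configuration_upper c (g : torus R -> R) (F : pred nat) :
  0 < c <= 1 -> expR (c * eps * d%:R) <= eps^-1 ->
  measurable_fun setT g -> (forall x, 0 <= g x) ->
  (forall k, (k < d)%N -> F k ->
     (mu (shifted eps k Q) <= \int[mu]_(x in shifted eps k Q) (g x)%:E)%E) ->
  (mu (\bigcup_(k in [set k | (k < d)%N && F k]) shifted eps k Q) <=
   (32 / c)%:E * \int[mu]_(x in \bigcup_(k in [set k | (k < d)%N]) shifted eps k Q)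
     (g x * ln (expR 1 + g x))%:E)%E.
Proof.
move=> c01 hc mg g0 hF; have /andP[c0 c1] := c01.
set D := \bigcup_(k in [set k | (k < d)%N]) _.
pose phi x : R := g x * ln (expR 1 + g x).
pose q k x : bool := F k && (x \in shifted eps k Q).
pose n : R := \sum_(k < d) (F k)%:R.
have mD : measurable D.
  by apply: fin_bigcup_measurable => [|k kd]; [exact: finite_II|exact: measurable_shifted].
have mq k : (k < d)%N -> measurable_fun setT (fun x => (q k x)%:R : R).
  move=> kd; rewrite (_ : (fun _ => _) = fun x => (F k)%:R * \1_(shifted eps k Q) x).
    by apply: measurable_funM => //; apply: measurable_indic; exact: measurable_shifted.
  by apply/funext => x; rewrite /q indicE -natrM mulnb.
have mphi : measurable_fun setT phi.
  apply: measurable_funM => //; apply: measurableT_comp; first exact: measurable_ln.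
  exact: measurable_funD.
have phi0 x : 0 <= phi x.
  by rewrite mulr_ge0// (le_trans _ (ln_expR1D_ge1 (g0 x))).
(* If [N] selected members contain [x], the [p k x] add up to [((1 + c) ^+ N - 1) / c]. *)
pose p k x : R := (q k x)%:R * \prod_(l < k) (1 + c * (q l x)%:R).
have p0 k x : 0 <= p k x.
  by rewrite mulr_ge0// prodr_ge0// => l _; rewrite addr_ge0// mulr_ge0// ltW.
have mp k : (k < d)%N -> measurable_fun setT (p k).
  move=> kd; apply: measurable_funM; first exact: mq.
  apply: measurable_prod => l _; apply: measurable_funD => //.
  by apply: measurable_funM => //; apply: mq; rewrite (ltn_trans _ kd).
have int_p k : (k < d)%N -> (\int[mu]_(x in D) (p k x)%:E <= (2 * w * (F k)%:R)%:E)%E.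
  move=> kd; case Fk : (F k); last first.
    by rewrite mulr0 integral0_eq// => x _; rewrite /p /q Fk mul0r.
  rewrite mulr1; apply: le_trans (shifted_overlap_le kd (ltW c0) hc).
  apply: (@le_trans _ _ (\int[mu]_x (p k x)%:E)%E).
    by apply: ge0_subset_integral => //; [by apply/measurable_EFinP; exact: mp|move=> x _; rewrite lee_fin].
  apply: ge0_le_integral => //.
  - by move=> x _; rewrite lee_fin.
  - by apply/measurable_EFinP; exact: mp.
  - apply/measurable_EFinP; apply: measurable_funM.
      by apply: measurable_indic; exact: measurable_shifted.
    apply: measurable_prod => l _; apply: measurable_funD => //.
    apply: measurable_funM => //; apply: measurable_indic; apply: measurable_shifted.
    by rewrite (ltn_trans _ kd).
  move=> x _; rewrite lee_fin /p /q Fk/= [\1__ x]indicE ler_wpM2l//.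
  (* Forgetting the selection only enlarges the factors. *)
  apply: ler_prod => l _; rewrite addr_ge0 ?mulr_ge0 ?(ltW c0)//=.
  by rewrite lerD2l ler_wpM2l ?(ltW c0)// indicE; case: (F l).
have n0 : 0 <= n by rewrite sumr_ge0.
have mu_le : (mu (\bigcup_(k in [set k | (k < d)%N && F k]) shifted eps k Q) <=
    (n * w)%:E)%E.
  pose A k := if F k then shifted eps k Q else set0.
  rewrite (_ : \bigcup_(k in _) _ = \big[setU/set0]_(k < d) A k); last first.
    rewrite -(bigcup_mkord d A); apply/seteqP; split => x [k /=].
      by move=> /andP[kd Fk] xk; exists k => //; rewrite /A Fk.
    by rewrite /A; case: ifP => // Fk kd xk; exists k => //=; rewrite kd.
  rewrite (le_trans (Boole_inequality mu (A := A) (n := d) _))//.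
    by move=> k kd; rewrite /A; case: ifP => // _; exact: measurable_shifted.
  rewrite mulr_suml -sumEFin; apply: lee_sum => k _.
  rewrite /A; case: ifP => _; last by rewrite measure0 mul0r.
  by rewrite mul1r [X in (X <= _)%E]haar_shifted.
apply: (le_trans mu_le).
have main : ((n * w)%:E <= \int[mu]_(x in D) (g x * \sum_(k < d) (q k x)%:R)%:E)%E.
  under eq_integral do rewrite mulr_sumr -sumEFin.
  rewrite ge0_integral_sum//; last 2 first.
  - move=> k; apply/measurable_funTS/measurable_EFinP; apply: measurable_funM => //.
    exact: mq.
  - by move=> k x _; rewrite lee_fin mulr_ge0.
  rewrite /n mulr_suml -sumEFin; apply: lee_sum => k _.
  case Fk : (F k); last first.
    rewrite mul0r integral_ge0// => x _; rewrite lee_fin mulr_ge0//.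
  rewrite mul1r -(haar_shifted (ltn_ord k)) (le_trans (hF k (ltn_ord k) Fk))//.
  rewrite (integral_indicr mu (D := D)); last by move=> x xk; exists k => /=.
  by rewrite le_eqVlt; apply/orP; left; apply/eqP/eq_integral => x _; rewrite /q Fk indicE.
have : (\int[mu]_(x in D) (g x * \sum_(k < d) (q k x)%:R)%:E <=
   (16 / c)%:E * \int[mu]_(x in D) (phi x)%:E + (n * w / 2)%:E)%E.
  apply: (@le_trans _ _ (\int[mu]_(x in D)
      ((16 / c)%:E * (phi x)%:E + 4^-1%:E * \sum_(k < d) (p k x)%:E))%E).
    apply: ge0_le_integral => //.
    - by move=> x _; rewrite lee_fin mulr_ge0// sumr_ge0.
    - apply/measurable_funTS/measurable_EFinP; apply: measurable_funM => //.
      by apply: (@measurable_sum _ _ _ _ _ _ (fun k : 'I_d => fun x => (q k x)%:R)) => k; exact: mq.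
    - apply/measurable_funTS; apply: emeasurable_funD.
        by apply: emeasurable_funM => //; exact/measurable_EFinP.
      apply: emeasurable_funM => //; apply: emeasurable_sum => k.
      by apply/measurable_EFinP; exact: mp.
    move=> x _; rewrite sumEFin -!EFinM -EFinD lee_fin.
    exact: (mul_overlap_le (fun k => q k x) d c01 (g0 x)).
  have c16 : 0 <= 16 / c by rewrite divr_ge0// ltW.
  rewrite ge0_integralD//; last 4 first.
  - by move=> x _; rewrite mule_ge0 ?lee_fin.
  - by apply/measurable_funTS; apply: emeasurable_funM => //; exact/measurable_EFinP.
  - by move=> x _; rewrite mule_ge0 ?lee_fin// sume_ge0// => k _; rewrite lee_fin.
  - apply/measurable_funTS; apply: emeasurable_funM => //; apply: emeasurable_sum => k.
    by apply/measurable_EFinP; exact: mp.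
  have mpE (k : 'I_d) : measurable_fun D (fun x => (p k x)%:E).
    by apply/measurable_funTS/measurable_EFinP; exact: mp.
  rewrite ge0_integralZl//; last 2 first.
  - exact/measurable_funTS/measurable_EFinP.
  - by move=> x _; rewrite lee_fin.
  rewrite leeD2l// ge0_integralZl//; last 2 first.
  - exact: emeasurable_sum.
  - by move=> x _; rewrite sume_ge0// => k _; rewrite lee_fin.
  rewrite ge0_integral_sum//; last by move=> k x _; rewrite lee_fin.
  (* Each selected term costs at most [2 * w], so a quarter of the sum is at most [n * w / 2]. *)
  rewrite (@le_trans _ _ (4^-1%:E * \sum_(k < d) (2 * w * (F k)%:R)%:E)%E)//.
    by rewrite lee_wpmul2l// ?lee_fin//; apply: lee_sum => k _; exact: int_p.
  rewrite sumEFin -EFinM lee_fin -mulr_sumr -/n.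
  by lra.
move=> /(le_trans main).
have : (0 <= \int[mu]_(x in D) (phi x)%:E)%E.
  by apply: integral_ge0 => x _; rewrite lee_fin.
(* A finite integral allows subtracting [n * w / 2]; an infinite one makes the bound trivial. *)
rewrite -/(phi _); case: (\int[mu]_(x in D) (phi x)%:E)%E => [r||]//.
  rewrite -!EFinM -EFinD !lee_fin => r0 h.
  have -> : 32 / c * r = 2 * (16 / c * r) by field; rewrite gt_eqF.
  lra.
by move=> _ _; rewrite mulry gtr0_sg ?mul1e ?leey// divr_gt0.
Qed.

(** Serves the pieces of [Q_k] outside and inside [Q], with [r] equal to [1 - eps] and [eps]. *)
Lemma haar_prod_side_mul k (r : R) a b : (k < nonfree m)%N ->
  (forall i, (i < nonfree m)%N -> [/\ 0 <= a i, a i <= b i & b i <= 1]) ->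
  (forall i, (i < nonfree m)%N ->
    b i - a i = (if i == k then r else 1) * side R m i) ->
  mu (box t (nonfree m) a b) = (r * w)%:E.
Proof.
move=> kN ab abE; rewrite haar_box//; congr EFin.
rewrite (eq_bigr (fun i : 'I__ =>
    (if i == Ordinal kN then r else 1) * side R m i)).
  by rewrite big_split/= -big_mkcond/= big_pred1_eq.
by move=> i _; rewrite abE.
Qed.

(** The pieces of the [Q_k] lying beyond [Q] in coordinate [k] are disjoint, and each has measure
    [(1 - eps) * w >= w / 2]. *)
Lemma configuration_union_ge :
  ((d%:R * (w / 2))%:E <=
   mu (\bigcup_(k in [set k | (k < d)%N]) shifted eps k Q))%E.
Proof.
have /andP[e0 e1] := eps_range.
pose A k := if (k < d)%N then box t (nonfree m)
  (fun i => if i == k then side R m i else 0)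
  (fun i => shift_lo eps m k i + side R m i) else set0.
have mA k : measurable (A k).
  by rewrite /A; case: ifP => // _; exact: measurable_box.
have muA k : (k < d)%N -> mu (A k) = ((1 - eps) * w)%:E.
  move=> kd; rewrite /A kd (haar_prod_side_mul (ltdN kd) (r := 1 - eps))//.
    move=> i iN; have := shift_lo_bounds k iN.
    have s0 := side_gt0 R m i; have s1 := side_le_half R m1 iN.
    have es0 : 0 < eps * side R m i by rewrite mulr_gt0.
    by rewrite /shift_lo; case: eqP => _ [? ? ?]; split; lra.
  by move=> i _; rewrite /shift_lo; case: eqP => _; ring.
have tA : trivIset setT A.
  have lt_disj k l x : A k x -> A l x -> k = l.
    rewrite /A; case: ifP => // kd; case: ifP => // ld xk xl.
    apply/eqP; apply/negPn/negP => /negPf kl.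
    have := xk k (ltdN kd); have := xl k (ltdN kd).
    rewrite /arc /shift_lo/= eqxx kl => /andP[_ x_lt] /andP[x_gt _].
    by move: x_lt; rewrite mul0r add0r ltNge ltW.
  by move=> k l _ _ [x [xk xl]]; exact: lt_disj xl.
have AQ : \big[setU/set0]_(k < d) A k `<=`
    \bigcup_(k in [set k | (k < d)%N]) shifted eps k Q.
  rewrite -bigcup_mkord => x [k kd]; rewrite /A; move: (kd) => /= -> xA.
  exists k => //; rewrite shifted_box ?ltdN// => i iN.
  have s0 := side_gt0 R m i.
  have es0 : 0 < eps * side R m i by rewrite mulr_gt0.
  have := xA i iN; rewrite /arc /shift_lo/=.
  by case: eqP => _ /andP[? ?]; lra.
apply: (@le_trans _ _ (mu (\big[setU/set0]_(k < d) A k))); last first.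
  apply: le_measure => //; rewrite inE; first exact: bigsetU_measurable.
  apply: fin_bigcup_measurable => [|k kd]; first exact: finite_II.
  exact: measurable_shifted.
rewrite measure_bigsetU//= (eq_bigr (fun=> ((1 - eps) * w)%:E)); last first.
  by move=> k _; rewrite muA.
rewrite sumEFin lee_fin sumr_const card_ord mulr_natl lerMn2r.
by apply/orP; right; rewrite mulrC ler_wpM2r ?(ltW w_gt0)//; lra.
Qed.

(** [Q] fills the proportion [eps] of [Q_k]; the height [2 / eps] puts the average strictly above
    the level 1. *)
Lemma average_shifted_scaled_indic k : (k < d)%N ->
  average mu (fun x => 2 / eps * \1_Q x) (shifted eps k Q) = 2%:E.
Proof.
move=> kd; have kN := ltdN kd; have /andP[e0 e1] := eps_range.
have mQ : measurable Q by rewrite /Q translate_Vset; exact: measurable_box.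
have mQk := measurable_shifted kd.
rewrite /average [X in fine X]haar_shifted///=.
have QQk : Q `&` shifted eps k Q =
    box t (nonfree m) (shift_lo eps m k) (side R m).
  rewrite /Q shifted_box// translate_Vset; apply/seteqP; split => x.
    move=> [xQ xQk] i iN; have /andP[_ ?] := xQ i iN.
    by have /andP[? _] := xQk i iN; exact/andP.
  move=> xB; split => i iN; have /andP[? ?] := xB i iN;
    have [? ? ?] := shift_lo_bounds k iN; rewrite /arc/=; lra.
rewrite (eq_integral (fun x => (2 / eps)%:E * (\1_Q x)%:E)%E); last first.
  by move=> x _; rewrite -EFinM ger0_norm// mulr_ge0// divr_ge0// ltW.
rewrite ge0_integralZl//; last 2 first.
- by apply/measurable_funTS/measurable_EFinP; exact: measurable_indic.
- by rewrite lee_fin divr_ge0// ltW.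
rewrite integral_indic// QQk [X in (_ * (_ * X))%E](haar_prod_side_mul kN (r := eps)).
- by rewrite -!EFinM; congr EFin; rewrite /w; field; rewrite !gt_eqF.
- move=> i iN; have [? ? ?] := shift_lo_bounds k iN.
  by have ? := side_le_half R m1 iN; split=> //; lra.
- by move=> i _; rewrite /shift_lo; case: eqP => _; ring.
Qed.

(** The divisions by [1] match the weak-type bound at level 1. *)
Lemma integral_scaled_indic_LlogL :
  (\int[mu]_x (`|2 / eps * \1_Q x| / 1 * ln (expR 1 + `|2 / eps * \1_Q x| / 1))%:E
   = (2 / eps * ln (expR 1 + 2 / eps) * w)%:E)%E.
Proof.
have /andP[e0 e1] := eps_range.
have mQ : measurable Q by rewrite /Q translate_Vset; exact: measurable_box.
have c0 : 0 <= 2 / eps by rewrite divr_ge0// ltW.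
rewrite (eq_integral (fun x =>
    (2 / eps * ln (expR 1 + 2 / eps))%:E * (\1_Q x)%:E)%E); last first.
  move=> x _; rewrite -EFinM divr1 indicE; congr EFin.
  by case: (x \in Q); rewrite ?mulr1 ?mulr0 ?normr0 ?mul0r// ger0_norm.
rewrite ge0_integralZl//; last 2 first.
- by apply/measurable_EFinP; exact: measurable_indic.
- by rewrite lee_fin mulr_ge0// (le_trans _ (ln_expR1D_ge1 c0)).
rewrite integral_indic// setIT /Q translate_Vset [X in (_ * X)%E]haar_box//; last first.
  move=> i iN; have s0 := side_gt0 R m i; have s1 := side_le_half R m1 iN.
  by split=> //; lra.
rewrite -EFinM; congr (_ * _)%:E.
by apply: eq_bigr => i _; rewrite subr0.
Qed.

End OneConfiguration.

(** * Families of configurations and the equivalence *)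

Lemma superlevel_configurations (R : realType) (mu : {measure set (torus R) -> \bar R})
    (J : Type) (eps : J -> R) (d : J -> nat) (Q : J -> set (torus R))
    (f : torus R -> R) (lam : R) : 0 < lam ->
  [set x | (lam%:E < maximal_op mu
     (\bigcup_j configuration_around (eps j) (d j) (Q j)) f x)%E] =
  \bigcup_j \bigcup_(k in [set k | (k < d j)%N &&
      `[< (lam%:E < average mu f (shifted (eps j) k (Q j)))%E >] ])
    shifted (eps j) k (Q j).
Proof.
move=> lam0; rewrite maximal_op_superlevel//; apply/seteqP; split => x.
  move=> [_ [[j _ [k kd <-]] lB] xB]; exists j => //.
  by exists k => //=; rewrite kd/=; apply/asboolP.
move=> [j _ [k /andP[kd /asboolP lB] xB]].
by exists (shifted (eps j) k (Q j)) => //; split => //; exists j => //; exists k.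
Qed.

Lemma sh_configuration_around (R : realType) (eps : R) d (Q : set (torus R)) :
  sh (configuration_around eps d Q) =
  \bigcup_(k in [set k | (k < d)%N]) shifted eps k Q.
Proof.
apply/seteqP; split => [x [_ [k kd <-] xk]|x [k kd xk]]; first by exists k.
by exists (shifted eps k Q) => //; exists k.
Qed.

Theorem corollary1p6 (R : realType) (mu : probability (torus R) R)
    (J : countType) (eps : J -> R) (d : J -> nat)
    (S : J -> set_system (torus R))
    (mu_haar : haar mu)
    (eps_range : forall j, 0 < eps j <= 2^-1)
    (d_pos : forall j, (1 <= d j)%N)
    (S_conf : forall j, is_configuration (eps j) (d j) (S j))
    (S_disj : trivIset setT (fun j => sh (S j))) :
  (exists K : R, forall (f : torus R -> R) (lam : R),
     measurable_fun setT f -> 0 < lam ->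
     (mu [set x | lam%:E < maximal_op mu (\bigcup_j S j) f x] <=
      K%:E * \int[mu]_x (`|f x| / lam * ln (expR 1 + `|f x| / lam))%:E)%E)
  <->
  (ereal_sup (range (fun j => (eps j * (d j)%:R / ln (eps j)^-1)%:E)) < +oo)%E.
Proof.
have /choice[mt mtP] : forall j, exists mt : nat * torus R,
    [/\ (1 <= mt.1)%N, Hgroup mt.1 mt.2, (d j <= nonfree mt.1)%N &
    S j = configuration_around (eps j) (d j) (translate mt.2 (@Vset R mt.1))].
  by move=> j; have [m [t ?]] := S_conf j; exists (m, t).
pose Q j := translate (mt j).2 (@Vset R (mt j).1).
have {mtP} mtP j : [/\ (1 <= (mt j).1)%N, Hgroup (mt j).1 (mt j).2 &
    (d j <= nonfree (mt j).1)%N] /\ S j = configuration_around (eps j) (d j) (Q j).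
  by have [? ? ? ?] := mtP j.
have SE : S = fun j => configuration_around (eps j) (d j) (Q j).
  by apply/funext => j; exact: (mtP j).2.
have mQk j k : (k < d j)%N -> measurable (shifted (eps j) k (Q j)).
  move=> kd; have [[m1 Ht dN] _] := mtP j.
  exact: (measurable_shifted (eps_range j) m1 Ht dN kd).
have ln_eps j : 0 < ln (eps j)^-1.
  have /andP[e0 e1] := eps_range j; rewrite ln_gt0// -invr1 ltf_pV2 ?posrE//; lra.
have mU j (D : set nat) : D `<=` [set k | (k < d j)%N] ->
    measurable (\bigcup_(k in D) shifted (eps j) k (Q j)).
  move=> Dd; apply: fin_bigcup_measurable => [|k /Dd kd]; last exact: mQk.
  exact: sub_finite_set Dd (finite_II _).
split.
  (* The 12 collects the 2 from [configuration_union_ge], the 2 of the height [2 / eps j] and the 3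
     from [ln_expR1D_le_ln]. The sign of [K] is not known, hence the absolute value. *)
  move=> [K KP]; apply: (@le_lt_trans _ _ (12 * `|K|)%:E); last exact: ltry.
  apply: ge_ereal_sup => _ [j _ <-]; rewrite lee_fin.
  have [[m1 Ht dN] Sj] := mtP j; have /andP[e0 e1] := eps_range j.
  pose f x := 2 / eps j * \1_(Q j) x.
  have mQ : measurable (Q j) by rewrite /Q translate_Vset; exact: measurable_box.
  have mf : measurable_fun setT f.
    by apply: measurable_funM => //; exact: measurable_indic.
  have := KP f 1 mf ltr01.
  rewrite SE superlevel_configurations// integral_scaled_indic_LlogL//.
  move=> /(le_trans _) H.
  have : (((d j)%:R * (\prod_(i < nonfree (mt j).1) side R (mt j).1 i / 2))%:E <=
      K%:E * (2 / eps j * ln (expR 1 + 2 / eps j) *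
        \prod_(i < nonfree (mt j).1) side R (mt j).1 i)%:E)%E.
    apply: H; apply: le_trans (configuration_union_ge mu_haar (eps_range j) m1 Ht dN) _.
    apply: le_measure; rewrite ?inE//; first exact: mU.
      by apply: measurable_bigcup_countType => i; apply: mU => k /andP[].
    move=> x [k kd xk]; exists j => //; exists k => //=; rewrite kd/=; apply/asboolP.
    by rewrite (average_shifted_scaled_indic mu_haar _ m1 Ht dN)// lte_fin ltr1n.
  set w := \prod_(i < _) _; have w0 : 0 < w by apply: prodr_gt0 => i _; exact: side_gt0.
  rewrite -EFinM lee_fin => {H} le_d.
  have y2 : 2 <= (eps j)^-1 by rewrite -[2]invrK lef_pV2 ?posrE ?invr_gt0.
  have L3 := ln_expR1D_le_ln y2.
  have L0 : 0 <= ln (expR 1 + 2 / eps j).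
    by rewrite (le_trans _ (ln_expR1D_ge1 _))// divr_ge0// ltW.
  have le_d' : (d j)%:R / 2 <= `|K| * (2 / eps j * (3 * ln (eps j)^-1)).
    rewrite -(ler_pM2r w0) (le_trans (y := K * (2 / eps j *
      ln (expR 1 + 2 / eps j) * w)))//; first by apply: le_trans le_d; lra.
    rewrite [X in X <= _]mulrA ler_wpM2r ?(ltW w0)//.
    rewrite (le_trans (y := `|K| * (2 / eps j * ln (expR 1 + 2 / eps j))))//.
      by rewrite ler_wpM2r ?ler_norm// mulr_ge0// divr_ge0// ltW.
    by rewrite ler_wpM2l// ler_wpM2l// divr_ge0// ltW.
  have := ler_wpM2l (ltW e0) le_d'.
  rewrite (_ : eps j * (`|K| * _) = 6 * `|K| * ln (eps j)^-1); last first.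
    by field; rewrite gt_eqF.
  by rewrite ler_pdivrMr//; lra.
move=> supA.
have [a [a1 aP]] : exists a : R, 1 <= a /\
    forall j, eps j * (d j)%:R <= a * ln (eps j)^-1.
  (* The maximum with 1 ensures [c = a^-1 <= 1], as [configuration_upper] requires. *)
  exists (Num.max 1 (fine (ereal_sup (range (fun j =>
    (eps j * (d j)%:R / ln (eps j)^-1)%:E))))).
  split=> [|j]; first by rewrite le_max lexx.
  rewrite -ler_pdivrMr// le_max; apply/orP; right.
  set A := ereal_sup _ in supA *.
  have : ((eps j * (d j)%:R / ln (eps j)^-1)%:E <= A)%E.
    by apply: ereal_sup_ubound; exists j.
  by case: A supA => [r||]//.
have a0 : 0 < a by lra.
pose c := a^-1.
have c01 : 0 < c <= 1 by rewrite invr_gt0 a0 invf_le1.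
exists (32 / c) => f lam mf lam0.
pose g x := `|f x| / lam.
have g0 x : 0 <= g x by rewrite divr_ge0// ltW.
have mg : measurable_fun setT g.
  by apply: measurable_funM => //; exact: measurableT_comp.
have K0 : 0 <= 32 / c by rewrite divr_ge0// ltW//; case/andP: c01.
have phi0 x : (0 <= (g x * ln (expR 1 + g x))%:E)%E.
  by rewrite lee_fin mulr_ge0// (le_trans _ (ln_expR1D_ge1 (g0 x))).
have mphi : measurable_fun setT (fun x => (g x * ln (expR 1 + g x))%:E).
  apply/measurable_EFinP; apply: measurable_funM => //.
  apply: measurableT_comp; first exact: measurable_ln.
  exact: measurable_funD.
rewrite SE superlevel_configurations//.
rewrite -ge0_integralZl//; last by move=> x _; exact: phi0.
(* The [G j] are the shadows, disjoint by hypothesis; each contains the selected members of its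
   configuration. *)
apply: (le_measure_bigcup_integral (G := fun j =>
    \bigcup_(k in [set k | (k < d j)%N]) shifted (eps j) k (Q j))) => //.
- by move=> j; apply: mU => k /andP[].
- by move=> j; exact: mU.
- by move=> j x [k /andP[kd _] xk]; exists k.
- rewrite (_ : (fun j => _) = (fun j => sh (S j)))//; apply/funext => j.
  by rewrite SE sh_configuration_around.
- exact: emeasurable_funM.
- by move=> x; apply: mule_ge0; [rewrite lee_fin|exact: phi0].
move=> j; have [[m1 Ht dN] _] := mtP j; have /andP[e0 e1] := eps_range j.
rewrite ge0_integralZl; last 4 first.
- exact: mU.
- exact: measurable_funTS.
- by move=> x _; exact: phi0.
- by rewrite lee_fin.
apply: configuration_upper => //.
  (* After taking logarithms this is [aP] divided by [a]. *)
  rewrite -[X in _ <= X]lnK ?posrE ?invr_gt0// ler_expR -mulrA /c.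
  by rewrite mulrC ler_pdivrMr// [X in _ <= X]mulrC.
move=> k kd /asboolP; rewrite /average.
have w0 : 0 < \prod_(i < nonfree (mt j).1) side R (mt j).1 i.
  by apply: prodr_gt0 => i _; exact: side_gt0.
have muQk := haar_shifted mu_haar (eps_range j) m1 Ht dN kd.
rewrite [X in fine X]muQk [X in _ -> (X <= _)%E]muQk /=.
rewrite [X in _ -> (_ <= X)%E](eq_integral (fun x => (lam^-1)%:E * `|f x|%:E)%E);
  last by move=> x _; rewrite -EFinM mulrC.
rewrite ge0_integralZl//; last 3 first.
- exact: mQk.
- by apply/measurable_funTS/measurable_EFinP; exact: measurableT_comp.
- by rewrite lee_fin invr_ge0 ltW.
(* [f] is only measurable, so its integral over [Q_k] may be infinite. *)
case: (\int[mu]_(x in _) _)%E => [r||].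
- rewrite -!EFinM lte_fin lee_fin => lam_r; rewrite ler_pdivlMl//.
  by move: lam_r; rewrite ltr_pdivlMl// mulrC => /ltW.
- by rewrite [X in (_ <= X)%E]mulry gtr0_sg ?mul1e ?leey// invr_gt0.
- by rewrite mulrNy gtr0_sg ?mul1e// invr_gt0.
Qed.
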